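(* The Whittle index of the single-user sub-problem (MDP $\Omega$) for state $(x,\lambda)$, $x\in\{1,2,\dots\}$, $\lambda\in\{0,1\}$, is $$I(x,\lambda)=\begin{cases}0 & \text{if }\lambda=0;\\[2pt] \dfrac{x^2}{2}-\dfrac{x}{2}+\dfrac{x}{p} & \text{if }\lambda=1.\end{cases}$$
   Context: MDP $\Omega$ (with arrival probability $p\in(0,1)$ and real update cost $c$). The state in slot $t=0,1,\dots$ is $\mathbf{S}(t)=(X(t),\Lambda(t))$ with age $X(t)\in\{1,2,\dots\}$ and arrival indicator $\Lambda(t)\in\{0,1\}$, the $\Lambda(t)$ being i.i.d. with $P[\Lambda(t)=1]=p$. The action is $A(t)\in\{0,1\}$ ($1$: update, $0$: idle). The next age is $X(t+1)=1$ if $A(t)=1$ and $\Lambda(t)=1$, and $X(t+1)=X(t)+1$ otherwise. The immediate cost is $C((x,\lambda),a)=(x+1-x a\lambda)+c\,a$. A policy $\mu$ chooses $A(t)$ for each slot, possibly at random and depending on the history of states up to slot $t$ and actions up to slot $t-1$; its average cost is $J(\mu)=\limsup_{T\to\infty}\frac1{T+1}E_\mu\left[\sum_{t=0}^T C(\mathbf{S}(t),A(t))\right]$. A policy is $\Omega$-optimal if it minimizes $J(\mu)$ over all policies. Whittle index: $I(\mathbf{s})$ is the cost $c$ that makes both actions, to update and to idle, equally desirable for state $\mathbf{s}$; that is, for this $c$, each of the two actions at $\mathbf{s}$ is prescribed by some $\Omega$-optimal deterministic stationary policy. *)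

(* Defs.v *)
From mathcomp Require Import all_boot all_order all_algebra.
From mathcomp Require Import all_classical all_reals all_analysis.

Set Implicit Arguments.
Unset Strict Implicit.
Unset Printing Implicit Defensive.

Import Order.TTheory GRing.Theory Num.Theory.
Local Open Scope ring_scope.

(* (x, lambda); ages are positive, and a process started at a positive age
   never visits the junk states (0, lambda). *)
Definition state := (nat * bool)%type.

(* true = update, false = idle *)
Definition action := bool.

Definition next_age (s : state) (a : action) : nat :=
  if a && s.2 then 1%N else s.1.+1.

Definition cost (R : realType) (c : R) (s : state) (a : action) : R :=
  (s.1%:R + 1 - s.1%:R * a%:R * s.2%:R) + c * a%:R.

(* The history before slot t: the pairs (S(0), A(0)), ..., (S(t-1), A(t-1)),
   oldest first. *)
Definition history := seq (state * action).

(* A randomized history-dependent policy: [update_prob h s] is the conditional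
   probability of A(t) = 1 given the history h and the current state S(t) = s. *)
Record policy (R : realType) := Policy {
  update_prob :> history -> state -> R;
  update_prob_itv : forall h s, 0 <= update_prob h s <= 1 }.

Definition action_prob (R : realType) (mu : policy R)
    (h : history) (s : state) (a : action) : R :=
  if a then mu h s else 1 - mu h s.

Definition arrival_prob (R : realType) (p : R) (lambda : bool) : R :=
  if lambda then p else 1 - p.

(* Given the current age x, the arrivals and actions of the next slots, listed
   in w as pairs (Lambda(t), A(t)), determine the states of these slots. *)
Fixpoint trajectory (x : nat) (w : seq (bool * action)) : history :=
  if w is (lambda, a) :: w' then
    ((x, lambda), a) :: trajectory (next_age (x, lambda) a) w'
  else [::].

(* Probability, under mu and after the history h, that the next arrivals and
   actions are those occurring in tr: each Lambda(t) is Bernoulli(p) and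
   independent of the past, and A(t) is then drawn by mu. *)
Fixpoint trajectory_prob (R : realType) (p : R) (mu : policy R)
    (h tr : history) : R :=
  if tr is (s, a) :: tr' then
    arrival_prob p s.2 * action_prob mu h s a
      * trajectory_prob p mu (rcons h (s, a)) tr'
  else 1.

(* The expectation of C(S(0), A(0)) + ... + C(S(T), A(T)) under mu with
   X(0) = x0; it is a finite sum since only finitely many trajectories of
   length T + 1 start at age x0. *)
Definition expected_cost (R : realType) (p c : R) (x0 : nat) (mu : policy R)
    (T : nat) : R :=
  \sum_(w : T.+1.-tuple (bool * action))
    trajectory_prob p mu [::] (trajectory x0 w)
      * \sum_(sa <- trajectory x0 w) cost c sa.1 sa.2.

Definition average_cost (R : realType) (p c : R) (x0 : nat) (mu : policy R) :
    \bar R :=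
  limn_esup (fun T : nat => (T.+1%:R^-1 * expected_cost p c x0 mu T)%:E).

Definition optimal (R : realType) (p c : R) (x0 : nat) (mu : policy R) : Prop :=
  forall mu' : policy R, (average_cost p c x0 mu <= average_cost p c x0 mu')%E.

Lemma stationary_itv (R : realType) (f : state -> action) (s : state) :
  0 <= ((f s)%:R : R) <= 1.
Proof. by rewrite ler0n lern1 leq_b1. Qed.

Definition stationary (R : realType) (f : state -> action) : policy R :=
  @Policy R (fun _ s => (f s)%:R) (fun _ s => stationary_itv R f s).

Definition equally_desirable (R : realType) (p : R) (x0 : nat) (s : state)
    (c : R) : Prop :=
  forall a : action, exists f : state -> action,
    f s = a /\ optimal p c x0 (stationary R f).

Definition is_whittle_index (R : realType) (p : R) (x0 : nat) (s : state)
    (I : R) : Prop :=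
  equally_desirable p x0 s I /\
  forall c : R, equally_desirable p x0 s c -> c = I.

(* Main.v *)
Require Import Defs.
From mathcomp Require Import all_boot all_order all_algebra.
From mathcomp Require Import all_classical all_reals all_analysis.
From mathcomp Require Import ring lra.
Import Order.TTheory GRing.Theory Num.Theory.
Local Open Scope ring_scope.

(* For every update cost c the average-cost Bellman equation has an explicit
   solution. Write d x for the advantage of updating over idling at (x, true).
   For c > 0 there is a threshold H with I(H - 1) < c <= I(H); d is quadratic
   and negative below H, and linear with slope 1/p from H on, so it vanishes
   exactly at the x with I(x) = c. For c <= 0 it is x / p - c, which never vanishes.
   Hence at the cost I(x) either action at (x, true) extends to a policy without
   Bellman loss, and such policies are optimal.
   Conversely, a stationary policy with a positive Bellman loss at some state
   is strictly suboptimal: every age is reached from age 1 with positive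
   probability, and a policy that fails to return to age 1 loses at all large
   ages. Adding a small bounded function to the relative values turns this
   into a Bellman inequality with a strictly larger average cost. *)

Set Implicit Arguments.
Unset Strict Implicit.
Unset Printing Implicit Defensive.

(** * Finite-horizon expectations, one slot at a time *)

Lemma big_tuple_cons (R : nmodType) (T : finType) (n : nat)
    (F : n.+1.-tuple T -> R) :
  \sum_w F w = \sum_(x : T) \sum_(w : n.-tuple T) F [tuple of x :: w].
Proof.
rewrite pair_big /=.
rewrite (reindex (fun u : T * n.-tuple T => [tuple of u.1 :: u.2])) //=.
exists (fun w => (thead w, [tuple of behead w])) => [[x w] _|w _] /=.
  by rewrite theadE; congr pair; apply: val_inj.
by rewrite -tuple_eta.
Qed.

(** Generalizes [expected_cost] to any reward and any past history, so that induction on the horizon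
    can condition on the first slot. *)
Definition total_reward (R : realType) (p : R) (r : state -> action -> R)
    (mu : policy R) (h : history) (x n : nat) : R :=
  \sum_(w : n.-tuple (bool * action))
    trajectory_prob p mu h (trajectory x w)
      * \sum_(sa <- trajectory x w) r sa.1 sa.2.

Definition step_mean (R : realType) (p : R) (mu : policy R) (h : history)
    (x : nat) (F : state -> action -> R) : R :=
  \sum_(la : bool * action) arrival_prob p la.1
    * action_prob mu h (x, la.1) la.2 * F (x, la.1) la.2.

Lemma step_meanE (R : realType) (p : R) (mu : policy R) h x F :
  step_mean p mu h x F =
  p * (mu h (x, true) * F (x, true) true
       + (1 - mu h (x, true)) * F (x, true) false)
  + (1 - p) * (mu h (x, false) * F (x, false) true
       + (1 - mu h (x, false)) * F (x, false) false).
Proof.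
rewrite /step_mean -(pair_big predT predT (fun l a => arrival_prob p l
    * action_prob mu h (x, l) a * F (x, l) a)) /=.
by rewrite !big_bool /=; ring.
Qed.

Lemma step_mean1 (R : realType) (p : R) (mu : policy R) h x :
  step_mean p mu h x (fun _ _ => 1) = 1.
Proof. by rewrite step_meanE; ring. Qed.

Lemma sum_trajectory_prob (R : realType) (p : R) (mu : policy R) h x n :
  \sum_(w : n.-tuple (bool * action)) trajectory_prob p mu h (trajectory x w)
  = 1.
Proof.
elim: n h x => [|n IH] h x.
  rewrite (big_pred1 [tuple]) // => w.
  by apply/esym/eqP/val_inj; case: w => -[].
rewrite big_tuple_cons -(step_mean1 p mu h x); apply: eq_bigr => -[l a] _ /=.
by rewrite -mulr_sumr IH.
Qed.

Lemma total_rewardS (R : realType) (p : R) r (mu : policy R) h x n :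
  total_reward p r mu h x n.+1 = step_mean p mu h x (fun s a =>
    r s a + total_reward p r mu (rcons h (s, a)) (next_age s a) n).
Proof.
rewrite /total_reward big_tuple_cons; apply: eq_bigr => -[l a] _ /=.
under eq_bigr do rewrite big_cons /= mulrDr.
rewrite big_split /= -mulr_suml -!mulr_sumr sum_trajectory_prob mulr1.
rewrite mulrDr; congr (_ + _); rewrite mulr_sumr.
by apply: eq_bigr => w _; rewrite mulrA.
Qed.

Lemma step_mean_le (R : realType) (p : R) (mu : policy R) h x F G :
  0 < p < 1 -> (forall l a, F (x, l) a <= G (x, l) a) ->
  step_mean p mu h x F <= step_mean p mu h x G.
Proof.
move=> /andP[p0 p1] FG; apply: ler_sum => -[l a] _ /=.
rewrite ler_wpM2l // mulr_ge0 //.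
  by case: l; rewrite /arrival_prob ?subr_ge0 ltW.
have /andP[m0 m1] := update_prob_itv mu h (x, l).
by case: a; rewrite /action_prob ?subr_ge0.
Qed.

Lemma step_meanD (R : realType) (p : R) (mu : policy R) h x F G :
  step_mean p mu h x (fun s a => F s a + G s a) =
  step_mean p mu h x F + step_mean p mu h x G.
Proof. by rewrite !step_meanE; ring. Qed.

Lemma step_meanZ (R : realType) (p : R) (mu : policy R) h x k F :
  step_mean p mu h x (fun s a => k * F s a) = k * step_mean p mu h x F.
Proof. by rewrite !step_meanE; ring. Qed.

Lemma step_meanC (R : realType) (p : R) (mu : policy R) h x k :
  step_mean p mu h x (fun _ _ => k) = k.
Proof. by rewrite !step_meanE; ring. Qed.

Lemma next_age_gt0 s a : (0 < next_age s a)%N.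
Proof. by rewrite /next_age; case: ifP. Qed.

(** The drift inequality telescopes over the horizon, and [B] absorbs the terminal value of [k].
    Keeping [r] general allows costs and negated costs alike. *)
Lemma total_reward_ge (R : realType) (p : R) r (mu : policy R)
    (k : nat -> R) (B g : R) :
  0 < p < 1 -> (forall x, (0 < x)%N -> k x <= B) ->
  (forall h x, (0 < x)%N ->
    k x + g <= step_mean p mu h x (fun s a => r s a + k (next_age s a))) ->
  forall n h x, (0 < x)%N -> k x + n%:R * g <= total_reward p r mu h x n + B.
Proof.
move=> hp kB sub; elim=> [|n IH] h x x0.
  rewrite /total_reward mul0r addr0 (big_pred1 [tuple]) /=; last first.
    by move=> w; apply/esym/eqP/val_inj; case: w => -[].
  by rewrite big_nil mulr0 add0r kB.
rewrite total_rewardS -(step_meanC p mu h x B) -step_meanD.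
have -> : k x + n.+1%:R * g =
    k x + g + step_mean p mu h x (fun _ _ => n%:R * g).
  by rewrite step_meanC -natr1; ring.
apply: le_trans (lerD (sub h x x0) (lexx _)) _.
rewrite -step_meanD; apply: step_mean_le => // l a.
by rewrite -!addrA lerD2l IH // next_age_gt0.
Qed.

(** * Limits superior of time averages *)

Lemma limn_esup_average_ge (R : realType) (u : nat -> R) (g D : R) :
  (forall n, n.+1%:R * g - D <= u n) ->
  (g%:E <= limn_esup (fun n => (n.+1%:R^-1 * u n)%:E))%E.
Proof.
move=> gu; apply: le_ereal_inf_tmp => _ [A [N _ NA] <-].
apply/lee_subgt0Pr => e e0.
(* From index [M] on, the averaged constant [D / (n + 1)] is at most [e]. *)
have := archi_boundP (normr_ge0 (D / e)); set M := Num.bound _ => eM.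
apply: le_trans (ereal_sup_ubound _); last first.
  by exists (N + M)%N => //; apply: NA; rewrite /= leq_addr.
rewrite -EFinB lee_fin ler_pdivlMl //; apply: le_trans (gu _).
rewrite mulrBr lerD2l lerN2 -ler_pdivrMr //.
rewrite (le_trans (ler_norm _)) // (le_trans (ltW eM)) // ler_nat.
by rewrite leqW ?leq_addl.
Qed.

Lemma limn_esup_average_le (R : realType) (u : nat -> R) (g D : R) :
  (forall n, u n <= n.+1%:R * g + D) ->
  (limn_esup (fun n => (n.+1%:R^-1 * u n)%:E) <= g%:E)%E.
Proof.
move=> gu; apply/lee_addgt0Pr => e e0.
have := archi_boundP (normr_ge0 (D / e)); set M := Num.bound _ => eM.
apply: le_trans (ereal_inf_lbound _) _.
  by exists [set n | (M <= n)%N]%classic => //; exists M.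
apply: ge_ereal_sup => _ [n /= Mn <-].
rewrite -EFinD lee_fin ler_pdivrMl //; apply: le_trans (gu _) _.
rewrite mulrDr lerD2l -ler_pdivrMr //.
by rewrite (le_trans (ler_norm _)) // (le_trans (ltW eM)) // ler_nat leqW.
Qed.

(** * Average cost from drift inequalities *)

Lemma average_cost_ge_bounded (R : realType) (p c : R) (x0 : nat)
    (mu : policy R) (k : nat -> R) (B g : R) :
  0 < p < 1 -> (0 < x0)%N -> (forall x, (0 < x)%N -> k x <= B) ->
  (forall h x, (0 < x)%N ->
    k x + g <= step_mean p mu h x (fun s a => cost c s a + k (next_age s a))) ->
  (g%:E <= average_cost p c x0 mu)%E.
Proof.
move=> hp hx0 kB sub; apply: (@limn_esup_average_ge _ _ _ (B - k x0)) => n.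
have := total_reward_ge hp kB sub n.+1 [::] hx0.
rewrite /total_reward -/(expected_cost p c x0 mu n); lra.
Qed.

(** The lower bound on total rewards is applied to the negated cost and [- k], so [k] need only be
    bounded below. *)
Lemma average_cost_le (R : realType) (p c : R) (x0 : nat)
    (mu : policy R) (k : nat -> R) (B g : R) :
  0 < p < 1 -> (0 < x0)%N -> (forall x, (0 < x)%N -> B <= k x) ->
  (forall h x, (0 < x)%N ->
    step_mean p mu h x (fun s a => cost c s a + k (next_age s a)) <= k x + g) ->
  (average_cost p c x0 mu <= g%:E)%E.
Proof.
move=> hp hx0 kB sub; apply: (@limn_esup_average_le _ _ _ (k x0 - B)) => n.
have NkB x : (0 < x)%N -> - k x <= - B by move=> /kB; rewrite lerN2.
have Nsub h x : (0 < x)%N -> - k x - g <=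
    step_mean p mu h x (fun s a => - cost c s a - k (next_age s a)).
  by move=> /(sub h); rewrite !step_meanE; lra.
have := total_reward_ge hp NkB Nsub n.+1 [::] hx0.
have -> : total_reward p (fun s a => - cost c s a) mu [::] x0 n.+1 =
    - expected_cost p c x0 mu n.
  rewrite /total_reward /expected_cost -sumrN; apply: eq_bigr => w _.
  by rewrite -mulrN -sumrN.
lra.
Qed.

(* A nonnegative linear function is not bounded above, but subtracting
   [e * x * (x + 1) / 2] makes it so, and costs only a factor [1 + e]: the
   increment of [x * (x + 1) / 2] over a slot is at most the next age. *)
Lemma average_cost_ge (R : realType) (p c : R) (x0 : nat)
    (mu : policy R) (k : nat -> R) (K g : R) :
  0 < p < 1 -> (0 < x0)%N -> (forall x, (0 < x)%N -> k x <= K * x%:R) ->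
  (forall h x, (0 < x)%N ->
    k x + g <= step_mean p mu h x (fun s a => cost c s a + k (next_age s a))) ->
  (g%:E <= average_cost p c x0 mu)%E.
Proof.
move=> hp hx0 kK sub; apply/lee_subgt0Pr => e' e'0; rewrite -EFinB.
have D0 : 0 < `|c| + `|g| + 1 by rewrite ltr_wpDl // addr_ge0.
(* Chosen so that the errors [e * |c|], [e * |g|] and [e] add up to [e']. *)
pose e := e' / (`|c| + `|g| + 1).
have e0 : 0 < e by rewrite divr_gt0.
have e1 : 0 < 1 + e by lra.
have eE : e * `|c| + e * `|g| + e = e'.
  by rewrite /e; field; rewrite gt_eqF.
pose W x : R := x%:R * (x%:R + 1) / 2.
pose k' x := (k x - e * W x) / (1 + e).
(* [K ^ 2 / (2 * e)] is the maximum of [K * y - e * y ^ 2 / 2] over real [y]; the proof completes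
   the square. *)
have k'B x : (0 < x)%N -> k' x <= K ^+ 2 / (2 * e) / (1 + e).
  move=> xgt0; rewrite /k' ler_pM2r ?invr_gt0 //.
  apply: le_trans (_ : K * x%:R - e * W x <= _); first by rewrite lerD2r kK.
  rewrite ler_pdivlMr ?mulr_gt0 // /W -subr_ge0; set y : R := x%:R.
  have y0 : 0 <= y by [].
  have -> : K ^+ 2 - (K * y - e * (y * (y + 1) / 2)) * (2 * e) =
    (K - e * y) ^+ 2 + e ^+ 2 * y by field.
  by rewrite addr_ge0 ?sqr_ge0 // mulr_ge0 // sqr_ge0.
apply: (average_cost_ge_bounded (k := k') hp hx0 k'B) => h x xgt0.
rewrite -(ler_pM2l e1) -step_meanZ.
have -> : (1 + e) * (k' x + (g - e')) = k x + g + (e * (g - e') - e * W x - e').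
  rewrite /k'; field; lra.
apply: le_trans (lerD (sub h x xgt0) (lexx _)) _.
rewrite -(step_meanC p mu h x (e * (g - e') - e * W x - e')) -step_meanD.
apply: step_mean_le => // l a.
have -> : (1 + e) * (cost c (x, l) a + k' (next_age (x, l) a)) =
    cost c (x, l) a + k (next_age (x, l) a)
    + e * (cost c (x, l) a - W (next_age (x, l) a)).
  rewrite /k'; field; lra.
rewrite lerD2l.
have ca : - `|c| <= c * a%:R.
  by case: a; rewrite ?mulr1 ?mulr0 ?oppr_le0 // lerNl -normrN ler_norm.
have costW : - W x - `|c| <= cost c (x, l) a - W (next_age (x, l) a).
  move: ca; rewrite /cost /next_age /W /=.
  have := ler0n R x; have := sqr_ge0 (x%:R : R).
  by case: a; case: l => /=; rewrite -?[x.+1%:R]natr1; lra.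
have := ler_norm g.
nra.
Qed.

(** * The Bellman equation and its verification *)

(** Let [h] be the relative value, with [h 1 = 0]. At [(x, true)] idling is worth
    [x + 1 + h (x + 1)] and updating [1 + c]. Their difference is [d x], so
    [h (x + 1) = d x + c - x]. *)
Definition relative_value (R : realType) (c : R) (d : nat -> R) (x : nat) : R :=
  d x.-1 + c - x%:R + 1.

(* The loss of the action [a] at [s] in the Bellman equation, where [d x] is the
   value of idling minus that of updating at [(x, true)]; at [(x, false)] this
   difference is [- c]. *)
Definition gap (R : realType) (c : R) (d : nat -> R) (s : state) (a : action)
    : R :=
  if s.2 then (if a then 0 else d s.1) - Num.min 0 (d s.1)
  else (if a then c else 0) - Num.min 0 c.

(* The Bellman equation at age [x.+1] with average cost [g], written in terms of
   [d]; [d 0 = - c] normalizes the relative value of age 1 to 0. *)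
Definition bellman (R : realType) (p c g : R) (d : nat -> R) : Prop :=
  d 0 = - c /\ forall x, d x - x.+1%:R + g =
    (1 - p) * d x.+1 + p * Num.min 0 (d x.+1) + (1 - p) * Num.min 0 c.

Lemma gap_ge0 (R : realType) (c : R) d s a : 0 <= gap c d s a.
Proof.
by rewrite /gap; case: s.2; case: a; rewrite subr_ge0 ge_min lexx ?orbT.
Qed.

(** The drift of the relative value under any policy is accounted for exactly: its excess over the
    Bellman equation is the mean gap. *)
Lemma step_mean_gap (R : realType) (p c g : R) d (mu : policy R) h x :
  bellman p c g d -> (0 < x)%N ->
  step_mean p mu h x
    (fun s a => cost c s a + relative_value c d (next_age s a))
  = relative_value c d x + g + step_mean p mu h x (gap c d).
Proof.
move=> [d0 dS]; case: x => // x _; have := dS x.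
rewrite !step_meanE /gap /cost /next_age /relative_value /= d0.
rewrite -[x.+2%:R]natr1 => E.
have -> : g = (1 - p) * d x.+1 + p * Num.min 0 (d x.+1)
    + (1 - p) * Num.min 0 c - d x + x.+1%:R by lra.
ring.
Qed.

Lemma step_mean_stationary (R : realType) (p : R) f h x F :
  step_mean p (stationary R f) h x F =
  p * F (x, true) (f (x, true)) + (1 - p) * F (x, false) (f (x, false)).
Proof.
by rewrite step_meanE /=; case: (f (x, true)); case: (f (x, false)) => /=; ring.
Qed.

(** Up to a bounded error, the relative value has slope [p^-1 - 1 > 0]. These are the growth
    conditions of [average_cost_le] and [average_cost_ge]. *)
Lemma relative_value_bounds (R : realType) (p c K : R) d :
  0 < p < 1 -> (forall x, `|d x - x%:R / p| <= K) ->
  (forall x, (0 < x)%N -> c - K <= relative_value c d x) /\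
  (forall x, (0 < x)%N ->
    relative_value c d x <= (p^-1 + K + `|c| + 1) * x%:R).
Proof.
move=> /andP[p0 p1] dK.
have q1 : 1 < p^-1 by rewrite invf_gt1.
have K0 : 0 <= K := le_trans (normr_ge0 _) (dK 0%N).
have c0 := normr_ge0 c; have cc := ler_norm c.
split=> -[//|x] _; rewrite /relative_value /= -natr1;
  have := dK x; rewrite ler_norml => /andP[]; have := ler0n R x;
  set y := x%:R : R; set q := p^-1 in q1 *; nra.
Qed.

Lemma average_cost_bellman (R : realType) (p c g K : R) d x0 (mu : policy R) :
  0 < p < 1 -> (0 < x0)%N -> bellman p c g d ->
  (forall x, `|d x - x%:R / p| <= K) -> (g%:E <= average_cost p c x0 mu)%E.
Proof.
move=> hp hx0 bell dK; have [_ up] := relative_value_bounds c hp dK.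
apply: (average_cost_ge hp hx0 up) => h x xgt0.
rewrite (step_mean_gap _ _ bell) // lerDl -(step_meanC p mu h x 0).
by apply: step_mean_le => // l a; apply: gap_ge0.
Qed.

Lemma average_cost_greedy (R : realType) (p c g K : R) d x0 f :
  0 < p < 1 -> (0 < x0)%N -> bellman p c g d ->
  (forall x, `|d x - x%:R / p| <= K) ->
  (forall s, (0 < s.1)%N -> gap c d s (f s) = 0) ->
  (average_cost p c x0 (stationary R f) <= g%:E)%E.
Proof.
move=> hp hx0 bell dK gap0; have [low _] := relative_value_bounds c hp dK.
apply: (average_cost_le hp hx0 low) => h x xgt0.
rewrite (step_mean_gap _ _ bell) // step_mean_stationary !gap0 //.
by rewrite !mulr0 !addr0.
Qed.

(** * Explicit solution of the Bellman equation *)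

Definition arrival_index (R : realType) (p : R) (n : nat) : R :=
  n%:R ^+ 2 / 2 - n%:R / 2 + n%:R / p.

Lemma arrival_index_lt (R : realType) (p : R) (m n : nat) :
  0 < p < 1 -> (m < n)%N -> arrival_index p m < arrival_index p n.
Proof.
move=> /andP[p0 p1] mn; rewrite /arrival_index.
have q1 : 1 < p^-1 by rewrite invf_gt1.
have m0 : (0 : R) <= m%:R by [].
have : (m%:R + 1 : R) <= n%:R by rewrite natr1 ler_nat.
set a : R := m%:R in m0 *; set b : R := n%:R; set q := p^-1 in q1 * => ab.
rewrite -subr_gt0.
have -> : b ^+ 2 / 2 - b / 2 + b * q - (a ^+ 2 / 2 - a / 2 + a * q) =
  (b - a) * ((a + b - 1) / 2 + q) by field.
by rewrite mulr_gt0 //; lra.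
Qed.

(** The index vanishes at 0 and is unbounded; [n.+1] is the first age at which it reaches [c]. *)
Lemma arrival_index_bracket (R : realType) (p c : R) : 0 < p < 1 -> 0 < c ->
  exists n, arrival_index p n < c <= arrival_index p n.+1.
Proof.
move=> hp c0; have /andP[p0 p1] := hp.
have ex : exists n, c <= arrival_index p n.
  exists (Num.bound c); have := archi_boundP (ltW c0).
  have q1 : 1 < p^-1 by rewrite invf_gt1.
  rewrite /arrival_index; case: (Num.bound c) => [|n]; first by lra.
  rewrite -natr1; have n0 : (0 : R) <= n%:R by [].
  set b : R := n%:R in n0 *; set q := p^-1 in q1 * => cb; nra.
case: (ex_minnP ex) => -[|n] cn minn.
  by move: cn; rewrite /arrival_index; lra.
exists n; rewrite cn andbT ltNge; apply/negP => /minn.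
by rewrite ltnn.
Qed.

Lemma bellman_solution (R : realType) (p c : R) : 0 < p < 1 ->
  exists (g : R) (d : nat -> R), [/\ bellman p c g d,
    exists K, forall x, `|d x - x%:R / p| <= K
  & forall x, (0 < x)%N -> (d x == 0) = (c == arrival_index p x)].
Proof.
move=> hp; have /andP[p0 p1] := hp.
have pn0 : p != 0 by rewrite gt_eqF.
have p'n0 : 1 - p != 0 by rewrite subr_eq0 gt_eqF.
have [c0|c0] := leP c 0.
  (* Updating in every slot is optimal here: the age is then geometric with mean [p^-1], and each
     slot adds [c]. *)
  exists (p^-1 + c), (fun x => x%:R / p - c); split.
  - split=> [|x]; first by lra.
    rewrite (min_r c0) min_l; last first.
      by rewrite subr_ge0 (le_trans c0)// divr_ge0// ltW.
    rewrite -natr1; field => //.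
  - exists `|c| => x; rewrite addrAC subrr add0r normrN //.
  - move=> x x0; rewrite gt_eqF ?lt_eqF //.
      by have := arrival_index_lt hp x0; rewrite {1}/arrival_index; lra.
    by have := divr_gt0 (_ : 0 < x%:R) p0; rewrite ltr0n => /(_ x0); lra.
have [n /andP[cn cn1]] := arrival_index_bracket hp c0.
pose N : R := n.+1%:R.
have N1 : 1 <= N by rewrite ler1n.
(* [g] makes the quadratic [u] and the linear [v] match at [n.+1]. *)
pose g := (c + N * (N + 1) / 2 + (1 - p) * (N + p^-1) / p) / (N + (1 - p) / p).
have D0 : 0 < N + (1 - p) / p.
  rewrite ltr_wpDr ?(lt_le_trans ltr01) // divr_ge0 ?(ltW p0) //.
  by rewrite subr_ge0 ltW.
have gE : g * (N + (1 - p) / p) =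
    c + N * (N + 1) / 2 + (1 - p) * (N + p^-1) / p.
  by rewrite /g divfK // gt_eqF.
(* Since [N + (1 - p) / p] is positive, the bracket of [c] becomes
   [N - 1 + p^-1 < g <= N + p^-1]. *)
have gI : (g - (N + p^-1)) * (N + (1 - p) / p) = c - arrival_index p n.+1.
  rewrite mulrBl gE /arrival_index -/N; field => //.
have gI' : (g - (N - 1 + p^-1)) * (N + (1 - p) / p) = c - arrival_index p n.
  rewrite mulrBl gE /arrival_index (_ : n%:R = N - 1); last first.
    by rewrite /N -natr1; lra.
  field => //.
have gle : g <= N + p^-1.
  by rewrite -subr_le0 -(pmulr_lle0 _ D0) gI subr_le0.
have ggt : N - 1 + p^-1 < g.
  by rewrite -subr_gt0 -(pmulr_lgt0 _ D0) gI' subr_gt0.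
have q1 : 1 < p^-1 by rewrite invf_gt1.
(* [u] solves the recursion where the minimum is [d] itself, starting from [- c] at 0; [v] is the
   linear solution where the minimum is 0. *)
pose u x : R := x%:R * g - x%:R * (x%:R + 1) / 2 - c.
pose v x : R := (x%:R + p^-1 - g) / p.
have uv : u n - N + g = (1 - p) * v n.+1.
  rewrite /u /v (_ : n%:R = N - 1); last by rewrite /N -natr1; lra.
  rewrite -/N.
  apply/eqP; rewrite -subr_eq0; apply/eqP.
  transitivity (g * (N + (1 - p) / p) - 
     (c + N * (N + 1) / 2 + (1 - p) * (N + p^-1) / p)).
    field => //.
  by rewrite gE subrr.
have un : u n < 0.
  have -> : u n = (1 - p) * v n.+1 + N - g by rewrite -uv; lra.
  rewrite /v -/N.
  have -> : (1 - p) * ((N + p^-1 - g) / p) + N - g = (N - 1 + p^-1 - g) / p.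
    field => //.
  rewrite pmulr_llt0 ?invr_gt0 //; lra.
(* The increments [g - x] of [u] are positive up to [n] because [g > N], so [u] stays below
   [u n < 0]. *)
have u_neg x : (x <= n)%N -> u x < 0.
  move=> xn; apply: le_lt_trans un.
  rewrite /u.
  have : (x%:R : R) <= n%:R by rewrite ler_nat.
  have nN : n%:R = N - 1 by rewrite /N -natr1; lra.
  rewrite nN; have : (0 : R) <= x%:R by [].
  set a : R := x%:R => a0 aN.
  rewrite -subr_ge0.
  have -> : (N - 1) * g - (N - 1) * (N - 1 + 1) / 2 - c
     - (a * g - a * (a + 1) / 2 - c) =
     (N - 1 - a) * (g - N + (N - a) / 2) by field.
  by rewrite mulr_ge0 //; lra.
have v_ge0 x : (n < x)%N -> 0 <= v x.
  move=> nx; rewrite /v divr_ge0 ?(ltW p0) //.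
  have : N <= x%:R by rewrite ler_nat.
  lra.
have vgt x : (n.+1 < x)%N -> 0 < v x.
  move=> nx; rewrite /v divr_gt0 //.
  have : N + 1 <= x%:R by rewrite natr1 ler_nat.
  lra.
exists g, (fun x => if (x <= n)%N then u x else v x); split.
- split=> [|x]; first by rewrite leq0n /u; lra.
  rewrite (@min_l _ _ 0 c (ltW c0)).
  have [xn|nx|xn] := ltngtP x n.
  + by rewrite min_r ?ltW ?u_neg // /u -[x.+1%:R]natr1; lra.
  + rewrite min_l ?v_ge0 //; last by apply: (ltn_trans nx).
    rewrite /v -natr1; field => //.
  + rewrite xn min_l ?v_ge0 // -/N uv; lra.
(* The sum covers the finitely many ages up to [n]; beyond them [d x - x / p] is constant. *)
- exists (\sum_(i < n.+1) `|u i - i%:R / p| + `|(p^-1 - g) / p|) => x.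
  case: leqP => xn.
    rewrite -ltnS in xn.
    apply: ler_wpDr => //.
    by rewrite (bigD1 (Ordinal xn)) //= lerDl sumr_ge0.
  rewrite (_ : v x - _ = (p^-1 - g) / p); last by rewrite /v; lra.
  by rewrite lerDr sumr_ge0.
(* Only at [n.+1] can [d] vanish, and there [gI] turns [g = N + p^-1] into equality of [c] with the
   index. At other ages both equations fail. *)
- move=> x x0; case: leqP => xn.
    rewrite lt_eqF ?u_neg // gt_eqF //.
    apply: le_lt_trans cn; move: xn; rewrite leq_eqVlt => /orP[/eqP->//|xn].
    exact/ltW/arrival_index_lt.
  move: xn; rewrite leq_eqVlt => /orP[/eqP<-|nx].
    rewrite -[RHS]subr_eq0 -gI [RHS]mulf_eq0 (gt_eqF D0) orbF.
    rewrite /v mulf_eq0 invr_eq0 (negbTE pn0) orbF -/N.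
    by rewrite [RHS]subr_eq0 subr_eq0 eq_sym.
  rewrite gt_eqF ?vgt // lt_eqF //.
  by apply: le_lt_trans cn1 _; apply: arrival_index_lt.
Qed.

(** * Strict loss of policies with a positive gap *)

(* A bounded function that increases in mean by at least 1 in every slot, except
   that a bonus [L] is paid at age [y] and a bonus 1 for idling at an arrival at
   age [M] or more. It grows geometrically up to [y], which compensates
   possible resets, then drops below 0 and grows linearly up to [- p^-1] at [M],
   where a reset with probability [p] gains 1. *)
Lemma perturbation (R : realType) (p : R) (y M : nat) :
  0 < p < 1 -> (0 < y < M)%N ->
  exists (k : nat -> R) (L B : R), [/\ 0 < L, 0 <= B,
    forall x, (0 < x)%N -> k x <= B
  & forall x (a : bool), (0 < x)%N ->
    k x + 1 <= p * k (if a then 1%N else x.+1) + (1 - p) * k x.+1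
      + (if x == y then L else 0) + (if (M <= x)%N && ~~ a then 1 else 0)].
Proof.
move=> /andP[p0 p1] /andP[y0 yM].
have q1 : 1 < p^-1 by rewrite invf_gt1.
have pq : p * p^-1 = 1 by rewrite divff // gt_eqF.
pose r := (1 - p)^-1.
have rp : r * (1 - p) = 1 by rewrite mulVf // subr_eq0 gt_eqF.
have r1 : 1 < r by rewrite invf_gt1; lra.
pose C := (1 - p) / p.
have C0 : 0 < C by rewrite divr_gt0 // subr_gt0.
have CrE : C * (r - 1) = 1.
  by rewrite /C /r; field; rewrite !gt_eqF ?subr_gt0.
(* [k1] solves [(1 - p) * k1 (x + 1) = k1 x + 1] with [k1 1 = 0], so the mean gain is 1 even when an
   arrival would reset the age. *)
pose k1 x := C * (r ^+ x - r).
pose k2 x : R := (minn x M)%:R - M%:R - p^-1.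
have k1_ge0 x : (0 < x)%N -> 0 <= k1 x.
  case: x => // x _; rewrite /k1 mulr_ge0 ?(ltW C0) // subr_ge0 exprS.
  by rewrite ler_peMr ?exprn_ege1 ?ltW // (lt_trans ltr01).
have k1S x : (1 - p) * k1 x.+1 = k1 x + 1.
  rewrite /k1 exprS -[in RHS]CrE.
  transitivity (C * (r * (1 - p) * r ^+ x - r * (1 - p))).
    ring.
  rewrite rp; ring.
have k1mono x : (x <= y)%N -> k1 x <= k1 y.
  move=> xy; rewrite /k1 ler_pM2l // lerD2r ler_eXn2l //.
have k2_lt0 x : k2 x <= - p^-1.
  have : ((minn x M)%:R : R) <= M%:R by rewrite ler_nat geq_minr.
  rewrite /k2; lra.
(* [L] pays for the drop from [k1 y] to [k2 y.+1] and for the required gain of 1. *)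
exists (fun x => if (x <= y)%N then k1 x else k2 x),
  (k1 y + 1 - k2 y.+1), (k1 y); split.
- have := k2_lt0 y.+1; have := k1_ge0 y y0; lra.
- exact: k1_ge0.
- move=> x _; case: leqP => [/k1mono//|_].
  have := k2_lt0 x; have := k1_ge0 y y0; lra.
move=> x a x0.
have k11 : k1 1%N = 0 by rewrite /k1 expr1 subrr mulr0.
have k1E : (if (if a then 1%N else x.+1) <= y then k1 (if a then 1%N else x.+1)
   else k2 (if a then 1%N else x.+1))%N =
   if a then 0 else if (x < y)%N then k1 x.+1 else k2 x.+1.
  by case: a; rewrite ?y0.
rewrite k1E.
have [xy|yx|->] := ltngtP x y.
- rewrite (leqNgt M) (ltn_trans xy yM) /= !addr0 k1S.
  case: a {k1E} => //; first by lra.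
  by rewrite lerDr mulr_ge0 ?k1_ge0 // ltW.
- rewrite addr0; case: (leqP M x) => Mx.
    have kM z : (M <= z)%N -> k2 z = - p^-1.
      by move=> Mz; rewrite /k2 (minn_idPr Mz); lra.
    rewrite !kM ?leqW //; case: a {k1E} => /=; lra.
  rewrite andFb addr0.
  have -> : k2 x = k2 x.+1 - 1.
    by rewrite /k2 (minn_idPl Mx) (minn_idPl (ltnW Mx)) -natr1; lra.
  have := k2_lt0 x.+1; case: a {k1E}; nra.
- rewrite leqNgt yM addr0; have := k2_lt0 y.+1.
  case: a {k1E}; nra.
Qed.

Lemma average_cost_suboptimal (R : realType) (p c g K : R) d x0 f s :
  0 < p < 1 -> (0 < x0)%N -> bellman p c g d ->
  (forall x, `|d x - x%:R / p| <= K) ->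
  (0 < s.1)%N -> 0 < gap c d s (f s) ->
  exists2 e : R, 0 < e & ((g + e)%:E <= average_cost p c x0 (stationary R f))%E.
Proof.
case: s => y l /= hp hx0 bell dK y0 gap_gt0; have /andP[p0 p1] := hp.
have q1 : 1 < p^-1 by rewrite invf_gt1.
(* Large enough to exceed [y] and to force [d x >= x / p - K >= 1] from age [M] on. *)
pose M := ((Num.bound K).+1 + y.+1)%N.
have K0 : 0 <= K := le_trans (normr_ge0 _) (dK 0%N).
have dM x : (M <= x)%N -> 1 <= d x.
  move=> Mx; have := dK x; rewrite ler_norml => /andP[+ _].
  have := archi_boundP K0.
  have : ((Num.bound K).+1%:R : R) <= x%:R.
    by rewrite ler_nat (leq_trans _ Mx) // leq_addr.
  rewrite -natr1; have := ler0n R (Num.bound K).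
  move: (x%:R : R) ((Num.bound K)%:R : R) => z b; set q := p^-1 in q1 *; nra.
have yM : (0 < y < M)%N by rewrite y0 /= leq_addl.
have [k [L [B [L0 B0 kB kS]]]] := perturbation hp yM.
have P0 : 0 < arrival_prob p l by case: {gap_gt0} l => //=; rewrite subr_gt0.
pose G := arrival_prob p l * gap c d (y, l) (f (y, l)).
have G0 : 0 < G by rewrite mulr_gt0.
(* Scaled by [e], both bonuses are paid by gaps: [e * L] by the mean gap [G] at age [y], and [e] by
   idling at an arrival at age [M] or more, whose mean gap is at least [p]. *)
pose e := Num.min (G / L) p.
have e0 : 0 < e by rewrite lt_min p0 divr_gt0.
have eG : e * L <= G by rewrite -ler_pdivlMr // ge_min lexx.
have ep : e <= p by rewrite ge_min lexx orbT.
exists e => //; have [_ up] := relative_value_bounds c hp dK.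
apply: (@average_cost_ge _ _ _ _ _ (fun x => relative_value c d x + e * k x)
  (p^-1 + K + `|c| + 1 + e * B)) => // [x xgt0|h x xgt0].
  rewrite mulrDl lerD ?up // (le_trans (_ : _ <= e * B)) //.
    by rewrite ler_pM2l ?kB.
  by rewrite ler_peMr ?ler1n // mulr_ge0 // ltW.
have -> : step_mean p (stationary R f) h x (fun s a => cost c s a +
    (relative_value c d (next_age s a) + e * k (next_age s a))) =
  step_mean p (stationary R f) h x (fun s a => cost c s a +
    relative_value c d (next_age s a)) +
  e * step_mean p (stationary R f) h x (fun s a => k (next_age s a)).
  by rewrite -step_meanZ -step_meanD !step_meanE; ring.
rewrite (step_mean_gap _ _ bell) // !step_mean_stationary /next_age /=.
rewrite andbT andbF.
have := kS x (f (x, true)) xgt0.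
set E := p * k _ + _; rewrite -addrA => kE.
suff : e * ((if x == y then L else 0)
    + (if (M <= x)%N && ~~ f (x, true) then 1 else 0)) <=
  p * gap c d (x, true) (f (x, true))
   + (1 - p) * gap c d (x, false) (f (x, false)).
  move: kE; set Z := (if x == y then _ else _) + _ => kE.
  have := ler_wpM2l (ltW e0) kE; rewrite (mulrDr e (k x)) (mulrDr e E) mulr1.
  move: (e * k x) (e * E) (e * Z) => a b z; lra.
have p'0 : 0 <= 1 - p by lra.
have gapl : arrival_prob p l * gap c d (x, l) (f (x, l)) <=
    p * gap c d (x, true) (f (x, true))
   + (1 - p) * gap c d (x, false) (f (x, false)).
  by case: {+}l; rewrite ?lerDl ?lerDr mulr_ge0 ?gap_ge0 // ltW.
case: eqP => [xy|_].
  have -> : (M <= x)%N = false by rewrite xy leqNgt; case/andP: yM => _ ->.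
  rewrite addr0 (le_trans eG) // /G -xy //.
rewrite add0r; case: ifP => [/andP[Mx /negbTE fx]|_]; last first.
  by rewrite mulr0 addr_ge0 // mulr_ge0 ?gap_ge0 // ltW.
rewrite mulr1 (le_trans ep) // ler_wpDr ?mulr_ge0 ?gap_ge0 //.
rewrite fx /gap /= min_l ?subr0 ?ler_peMr ?dM ?ltW //.
exact: lt_le_trans ltr01 (dM x Mx).
Qed.

(** * Greedy actions and the Whittle index *)

Definition greedy (R : realType) (c : R) (d : nat -> R) (s : state) : action :=
  if s.2 then 0 <= d s.1 else c < 0.

Lemma gap_greedy (R : realType) (c : R) d s : gap c d s (greedy c d s) = 0.
Proof.
by rewrite /gap /greedy; case: s.2; case: leP => ?; rewrite subrr.
Qed.

Lemma gap_nogreedy (R : realType) (c : R) d (s : state) :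
  (if s.2 then d s.1 else c) != 0 -> 0 < gap c d s (~~ greedy c d s).
Proof.
rewrite /gap /greedy; case: s.2 => [|].
  by case: (ltgtP 0 (d s.1)) => //= z _; rewrite ?subr0 ?sub0r ?oppr_gt0.
by case: (ltgtP c 0) => //= z _; rewrite ?subr0 ?sub0r ?oppr_gt0.
Qed.

Lemma gap_indifferent (R : realType) (c : R) d (s : state) a :
  (if s.2 then d s.1 else c) = 0 -> gap c d s a = 0.
Proof. by rewrite /gap; case: s.2 => ->; rewrite if_same minxx subrr. Qed.

Theorem theorem17 (R : realType) (p : R) (hp : 0 < p < 1)
    (x0 : nat) (hx0 : (0 < x0)%N)
    (x : nat) (hx : (0 < x)%N) (lambda : bool) :
  is_whittle_index p x0 (x, lambda)
    (if lambda then x%:R ^+ 2 / 2 - x%:R / 2 + x%:R / p else 0).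
Proof.
set I := if _ then _ else _.
(* Both values of [lambda] are treated at once: the two actions at [(x, lambda)] tie at cost [c]
   exactly when [c = I]. *)
have criterion c d :
    (forall y, (0 < y)%N -> (d y == 0) = (c == arrival_index p y)) ->
    ((if lambda then d x else c) == 0) = (c == I).
  by move=> dI; rewrite /I; case: (lambda) => //; apply: dI.
split=> [a|c desirable].
  have [g [d [bell [K dK] /criterion dI]]] := bellman_solution I hp.
  (* At cost [I] both actions have zero gap at [(x, lambda)], so overriding the greedy action there
     keeps every gap zero. *)
  exists (fun s => if s == (x, lambda) then a else greedy I d s).
  rewrite eqxx; split=> // mu.
  apply: le_trans (average_cost_bellman mu hp hx0 bell dK).
  apply: (average_cost_greedy hp hx0 bell dK) => s _.
  case: eqP => [->|_]; last exact: gap_greedy.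
  by apply/gap_indifferent/eqP; rewrite dI.
have [g [d [bell [K dK] /criterion dI]]] := bellman_solution c hp.
apply/eqP; rewrite -dI; apply/negPn/negP => nz.
(* Without a tie, the non-greedy action has a positive gap, so an optimal policy prescribing it
   would cost strictly more than the greedy one. *)
have [f [fa fopt]] := desirable (~~ greedy c d (x, lambda)).
have fgap : 0 < gap c d (x, lambda) (f (x, lambda)).
  by rewrite fa; apply: gap_nogreedy.
have [e e0 ge] :=
  @average_cost_suboptimal _ _ _ _ _ _ _ _ (x, lambda) hp hx0 bell dK hx fgap.
have := le_trans (le_trans ge (fopt (stationary R (greedy c d))))
  (average_cost_greedy hp hx0 bell dK (fun s _ => gap_greedy c d s)).
rewrite lee_fin; lra.
Qed.
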